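(* Let $\lambda>0$, let $n\geq 1$, and let $\mathbb{M}^n=(\mathbb{R}^n,\|\cdot\|_1+\lambda\|\cdot\|_2)$. (i) If $\lambda\leq 1$, then $s(\mathbb{M}^n)\leq d(\mathbb{M}^n)\leq 2n$. (ii) If $\lambda\leq\sqrt{n}/(\sqrt{n}-1)$ (for $n=1$ this condition is regarded as always satisfied), then $d(\mathbb{M}^n)\geq s(\mathbb{M}^n)\geq 2n$.
   Context: $\|\cdot\|_1$ and $\|\cdot\|_2$ are the usual $\ell_1$- and Euclidean norms on $\mathbb{R}^n$. A Minkowski space $\mathbb{M}^n$ is an $n$-dimensional real normed space $(\mathbb{R}^n,\|\cdot\|)$. A Steiner tree of a finite set $N\subset\mathbb{M}^n$ is a finite tree $T$ whose vertex set $V(T)$ is a finite set of points of $\mathbb{M}^n$ with $N\subseteq V(T)$; its length is $\ell(T)=\sum_{xy\in E(T)}\|x-y\|$. The points of $N$ are called nodes or given points, the points of $V(T)\setminus N$ are called Steiner points. A Steiner minimal tree (SMT) of $N$ is a Steiner tree of $N$ of minimum length. $d(\mathbb{M}^n)$ (respectively $s(\mathbb{M}^n)$) denotes the maximum degree of a given point (respectively of a Steiner point) in an SMT, the maximum being taken over all SMTs (of all finite sets $N$) in $\mathbb{M}^n$. *)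

(* Defs.v *)
From mathcomp Require Import all_boot all_order all_algebra finmap.
From mathcomp Require Import all_classical all_reals all_analysis.

Set Implicit Arguments.
Unset Strict Implicit.
Unset Printing Implicit Defensive.

Import Order.TTheory GRing.Theory Num.Theory.

Local Open Scope ring_scope.

Definition l1norm (R : realType) (n : nat) (x : 'rV[R]_n) : R :=
  \sum_(i < n) `|x ord0 i|.

Definition l2norm (R : realType) (n : nat) (x : 'rV[R]_n) : R :=
  Num.sqrt (\sum_(i < n) x ord0 i ^+ 2).

Definition norm12 (R : realType) (n : nat) (lam : R) (x : 'rV[R]_n) : R :=
  l1norm x + lam * l2norm x.

(* A symmetric irreflexive relation contains the degenerate 2-cycles
   [:: x; y], so acyclicity only excludes simple cycles of length >= 3. *)
Definition is_tree (T : finType) (adj : rel T) : Prop :=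
  [/\ symmetric adj,
      irreflexive adj,
      (0 < #|T|)%N,
      forall x y : T, connect adj x y
    & forall c : seq T, ucycle adj c -> (size c <= 2)%N].

Record point_tree (R : realType) (n : nat) := PointTree {
  verts : {fset 'rV[R]_n};
  adj : rel verts;
  adj_tree : is_tree adj
}.

Definition degree (R : realType) (n : nat) (T : point_tree R n)
  (x : verts T) : nat := #|[pred y | adj x y]|.

(* The double sum ranges over ordered pairs, so it counts each edge twice. *)
Definition tree_length (R : realType) (n : nat) (nm : 'rV[R]_n -> R)
  (T : point_tree R n) : R :=
  2^-1 * \sum_(x : verts T) \sum_(y : verts T | adj x y) nm (val x - val y).

Definition steiner_tree (R : realType) (n : nat) (N : {fset 'rV[R]_n})
  (T : point_tree R n) : Prop := (N `<=` verts T)%fset.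

Definition steiner_minimal_tree (R : realType) (n : nat) (nm : 'rV[R]_n -> R)
  (N : {fset 'rV[R]_n}) (T : point_tree R n) : Prop :=
  steiner_tree N T /\
  forall T' : point_tree R n, steiner_tree N T' ->
    tree_length nm T <= tree_length nm T'.

Definition given_point_degrees (R : realType) (n : nat)
  (nm : 'rV[R]_n -> R) : set nat :=
  [set k | exists (N : {fset 'rV[R]_n}) (T : point_tree R n) (x : verts T),
      [/\ steiner_minimal_tree nm N T, val x \in N & degree x = k]].

Definition steiner_point_degrees (R : realType) (n : nat)
  (nm : 'rV[R]_n -> R) : set nat :=
  [set k | exists (N : {fset 'rV[R]_n}) (T : point_tree R n) (x : verts T),
      [/\ steiner_minimal_tree nm N T, val x \notin N & degree x = k]].

(* The maximum is taken as a supremum in the extended reals, which is total;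
   for a nonempty bounded set of naturals it is attained. *)
Definition max_degree (R : realType) (D : set nat) : \bar R :=
  ereal_sup [set (k%:R)%:E | k in D]%classic.

Definition max_given_degree (R : realType) (n : nat) (nm : 'rV[R]_n -> R)
  : \bar R := max_degree R (given_point_degrees nm).

Definition max_steiner_degree (R : realType) (n : nat) (nm : 'rV[R]_n -> R)
  : \bar R := max_degree R (steiner_point_degrees nm).

(* Main.v *)
Require Import Defs.
From mathcomp Require Import all_boot all_order all_algebra finmap.
From mathcomp Require Import all_classical all_reals all_analysis.
From mathcomp Require Import ring lra.

(* (i) If two edges xy, xz of a tree leave x with the same strict sign in
   coordinate i and lam <= 1, then moving their common end to a new Steiner
   point x + t e_i saves t in l1 length on each edge, shortens both in l2, and
   costs only (1 + lam) |t| <= 2 |t|.  So in a minimal tree each pair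
   (coordinate, sign) is used by at most one edge at x.

   (ii) The star joining 0 to the 2n points +-e_i has length 2n(1 + lam).  To see
   that it is minimal, root a competing tree.  For each i put a weight d_i of
   total 0 on the points +-e_j, equal to 1 + lam at e_i and -(1 + lam) at -e_i,
   and pair the edge from v to its parent with the functional phi_v whose i-th
   coordinate is the d_i-mass of the subtree of v.  Summation by parts turns
   the sum of these pairings into 2n(1 + lam), so it is enough that every phi_v
   lies in the dual ball.  The weight d_i also has -1 at a node k and +1 at a
   node l, chosen (the cuts separating e_i from -e_i form a chain) so that the
   i-th coordinate is at most max(1, lam) unless the edge cuts off e_i or -e_i
   alone.  In the first case the bound on lam puts phi_v in the dual ball; in
   the exceptional case the other coordinates are at most 1, so phi_v is in the
   dual ball as well. *)

Set Implicit Arguments.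
Unset Strict Implicit.

Import Order.TTheory GRing.Theory Num.Theory.

Local Open Scope ring_scope.

(** * Parent functions and insertion of a Steiner point *)

(* [par] is the parent function of a breadth-first search from [r]. *)
Lemma exists_parent (T : finType) (e : rel T) (r : T) :
  (forall x, connect e x r) ->
  exists (par : T -> T) (dep : T -> nat),
    [/\ par r = r,
        forall v, v != r -> e v (par v) /\ (dep (par v) < dep v)%N
      & forall v, e v r -> par v = r].
Proof.
move=> conn.
pose P v m := [exists p : m.-tuple T, path e v p && (last v p == r)].
have exP v : exists m, P v m.
  have /connectP[p ep lp] := conn v.
  by exists (size p); apply/existsP; exists (in_tuple p); rewrite ep -lp /=.
pose dep v := ex_minn (exP v).
have dep_le v (p : seq T) : path e v p -> last v p = r -> (dep v <= size p)%N.
  move=> ep lp; rewrite /dep; case: ex_minnP => m _; apply.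
  by apply/existsP; exists (in_tuple p); rewrite ep lp /=.
have dep_path v : exists p, [/\ path e v p, last v p = r & size p = dep v].
  rewrite /dep; case: ex_minnP => m /existsP[p /andP[ep /eqP lp]] _.
  by exists p; rewrite size_tuple.
have next v : v != r -> exists u, e v u && (dep u < dep v)%N.
  have [[|u p] [/= ep lp sz]] := dep_path v; first by rewrite lp eqxx.
  by case/andP: ep => vu ep _; exists u; rewrite vu -sz ltnS dep_le.
(* Neighbours of [r] go straight to [r], which gives the third clause; by [next] the default [v]
   never arises away from [r]. *)
pose par v := if (v == r) || e v r then r else
  odflt v [pick u | e v u && (dep u < dep v)%N].
have dep_r : dep r = 0%N by apply/eqP; rewrite -leqn0 (dep_le r [::]).
exists par, dep; split; first by rewrite /par eqxx.
  move=> v vr; have [u0 /andP[vu0 du0]] := next v vr.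
  rewrite /par (negPf vr) /=; case: ifP => [vr'|_].
    by rewrite vr' dep_r (leq_ltn_trans _ du0).
  case: pickP => [u /andP[]//|/(_ u0)].
  by rewrite vu0 du0.
by move=> v vr; rewrite /par vr orbT.
Qed.

(** At a deepest vertex of the cycle both neighbours are no deeper, hence equal by the hypothesis on
    [dep]; on a simple cycle of length at least 3 they would differ. *)
Lemma ucycle_size_le2 (T : finType) (e : rel T) (dep : T -> nat) (c : seq T) :
  symmetric e ->
  (forall u v w, e u v -> e u w ->
     (dep v <= dep u)%N -> (dep w <= dep u)%N -> v = w) ->
  ucycle e c -> (size c <= 2)%N.
Proof.
move=> esym lower; case: c => [//|x0 c0]; set c := x0 :: c0 => cyc.
have x0c : x0 \in c by rewrite inE eqxx.
have [u uc umax] : {u | u \in c & forall v, v \in c -> (dep v <= dep u)%N}.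
  by case: (arg_maxnP dep x0c) => u uc umax; exists u.
case: (rot_to uc) => i s def_s; rewrite leqNgt; apply/negP => sz.
have /andP[] : ucycle e (u :: s).
  by apply/andP; rewrite -def_s rot_cycle rot_uniq; apply/andP.
have sc v : v \in s -> (dep v <= dep u)%N.
  by move=> vs; apply: umax; rewrite -(mem_rot i) def_s inE vs orbT.
move: sz; rewrite -(size_rot i) def_s.
case: s sc {def_s} => [//|v s] sc; case/lastP: s sc => [//|s w] sc _.
rewrite /= rcons_path last_rcons => /and3P[uv _ wu] /and3P[_ + _].
rewrite (lower u v w) ?mem_rcons ?inE ?eqxx //; first by rewrite esym.
  by apply: sc; rewrite inE eqxx.
by apply: sc; rewrite inE mem_rcons inE eqxx orbT.
Qed.

Lemma sum_rel_flip (V : nmodType) (T : finType) (A : rel T) (F : T -> T -> V) :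
  \sum_u \sum_(v | A u v) F u v = \sum_u \sum_(v | A v u) F v u.
Proof. exact: (exchange_big_dep predT). Qed.

(** Depth drops towards the root, so distinct vertices have distinct parent edges; any other edge
    only adds a nonnegative length. *)
Lemma tree_length_ge (R : realType) (n : nat) (nm : 'rV[R]_n -> R)
    (T : point_tree R n) (r : verts T) (par : verts T -> verts T)
    (dep : verts T -> nat) :
  (forall x, 0 <= nm x) -> (forall x, nm (- x) = nm x) ->
  (forall v, v != r -> adj v (par v) /\ (dep (par v) < dep v)%N) ->
  \sum_(v | v != r) nm (val v - val (par v)) <= tree_length nm T.
Proof.
move=> nm0 nmN parP; rewrite /tree_length ler_pdivlMl //.
have [asym _ _ _ _] := adj_tree T.
pose A u v := (u != r) && (v == par u).
have sA : \sum_(v | v != r) nm (val v - val (par v)) =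
    \sum_u \sum_(v | A u v) nm (val u - val v).
  rewrite big_mkcond; apply: eq_bigr => u _; rewrite /A.
  case: ifP => /= _; first by rewrite big_pred1_eq.
  by rewrite big_pred0_eq.
(* Doubling the sum and flipping one copy matches it with [tree_length], which runs over ordered
   pairs. *)
rewrite mulr_natl mulr2n sA [X in _ + X <= _]sum_rel_flip -big_split /=.
apply: ler_sum => u _; rewrite [X in X + _ <= _]big_mkcond.
rewrite [X in _ + X <= _]big_mkcond -big_split /=.
rewrite [leRHS]big_mkcond; apply: ler_sum => v _.
rewrite -[val v - val u]opprB nmN.
have AE x y : A x y -> adj x y /\ (dep y < dep x)%N.
  by case/andP=> /parP + /eqP ->.
case Auv: (A u v); case Avu: (A v u); rewrite ?addr0 ?add0r //.
- have [_ d1] := AE _ _ Auv; have [_ d2] := AE _ _ Avu.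
  by have := ltn_trans d1 d2; rewrite ltnn.
- by have [-> _] := AE _ _ Auv.
- by have [+ _] := AE _ _ Avu; rewrite asym => ->.
- by case: ifP.
Qed.

Section ParentTree.
Variables (R : realType) (n : nat) (V : {fset 'rV[R]_n}) (r : 'rV[R]_n).
Variables (par : 'rV[R]_n -> 'rV[R]_n) (dep : 'rV[R]_n -> nat).
Hypothesis rV : r \in V.
Hypothesis parP : forall v, v \in V -> v != r ->
  par v \in V /\ (dep (par v) < dep v)%N.

Definition parent_rel (u v : V) : bool :=
  (val u != r) && (val v == par (val u)).

Definition parent_adj (u v : V) : bool := parent_rel u v || parent_rel v u.

(** Connectedness is by induction on depth. For acyclicity, the only neighbour of [u] that is no
    deeper than [u] is its parent. *)
Lemma parent_adj_tree : is_tree parent_adj.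
Proof.
have lt u v : parent_rel u v -> (dep (val v) < dep (val u))%N.
  by case/andP=> ur /eqP ->; have [] := parP (valP u) ur.
have sym : symmetric parent_adj by move=> u v; apply: orbC.
split=> //.
- by move=> u; rewrite /parent_adj orbb; apply/negP => /lt; rewrite ltnn.
- by apply/card_gt0P; exists [` rV]%fset.
- suff toroot u : connect parent_adj u [` rV]%fset.
    move=> x y; apply: connect_trans (toroot x) _.
    by rewrite (sym_connect_sym sym).
  have [m] := ubnP (dep (val u)); elim: m u => // m IH u; rewrite ltnS => du.
  have [ur|ur] := eqVneq (val u) r.
    by have -> : u = [` rV]%fset by apply: val_inj.
  have [pV dp] := parP (valP u) ur.
  apply: connect_trans (IH [` pV]%fset (leq_trans dp du)).
  by apply: connect1; rewrite /parent_adj /parent_rel ur eqxx.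
- move=> c; apply: (@ucycle_size_le2 _ _ (dep \o val)) => // u v w.
  have low x : parent_adj u x -> (dep (val x) <= dep (val u))%N ->
      val x = par (val u).
    by case/orP=> [/andP[_ /eqP//]|/lt]; rewrite ltnNge => /negPf ->.
  move=> uv uw dv dw; apply: val_inj.
  by rewrite (low v) // (low w).
Qed.

Definition parent_tree : point_tree R n := PointTree parent_adj_tree.

Lemma parent_tree_length (nm : 'rV[R]_n -> R) :
  (forall x, 0 <= nm x) -> (forall x, nm (- x) = nm x) ->
  tree_length nm parent_tree <= \sum_(v <- V | v != r) nm (v - par v).
Proof.
move=> nm0 nmN; rewrite /tree_length ler_pdivrMl //.
have sA : \sum_(v <- V | v != r) nm (v - par v) =
    \sum_u \sum_(v | parent_rel u v) nm (val u - val v).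
  rewrite big_seq_fsetE /= big_mkcond; apply: eq_bigr => u _.
  case: ifP => ur; last by rewrite big_pred0 // => v; rewrite /parent_rel ur.
  have [pV _] := parP (valP u) ur.
  rewrite (big_pred1 [` pV]%fset) // => v.
  by rewrite /parent_rel ur -val_eqE.
rewrite mulr_natl mulr2n sA [X in _ <= _ + X]sum_rel_flip -big_split /=.
apply: ler_sum => u _.
rewrite [X in _ <= X + _]big_mkcond [X in _ <= _ + X]big_mkcond -big_split /=.
rewrite [leLHS]big_mkcond.
apply: ler_sum => v _; rewrite -[val v - val u]opprB nmN.
rewrite /parent_adj.
case: (parent_rel u v); case: (parent_rel v u) => /=; rewrite ?addr0 ?add0r //.
by rewrite lerDl.
Qed.

End ParentTree.

(** Rooting the tree at [x] makes [y] and [z] children of [x]. Both are then hung under [p], and [p]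
    under [x]; all other parent edges stay. *)
Lemma add_steiner_point (R : realType) (n : nat) (nm : 'rV[R]_n -> R)
    (T : point_tree R n) (x y z : verts T) (p : 'rV[R]_n) :
  (forall u, 0 <= nm u) -> (forall u, nm (- u) = nm u) ->
  y != z -> adj y x -> adj z x -> p \notin verts T ->
  exists2 T' : point_tree R n, verts T' = (p |` verts T)%fset &
    tree_length nm T' <= tree_length nm T
      - (nm (val y - val x) + nm (val z - val x))
      + (nm (p - val x) + nm (val y - p) + nm (val z - p)).
Proof.
move=> nm0 nmN yz yx zx pT; have [_ airr _ conn _] := adj_tree T.
have [par [dep [_ parP parx]]] := exists_parent (fun v => conn v x).
have ne_x v : adj v x -> v != x.
  by apply: contraTneq => ->; rewrite airr.
pose parv v := if insub v is Some u then val (par u) else v.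
pose depv v := if insub v is Some u then dep u else 0%N.
pose par' v := if v == p then val x
  else if (v == val y) || (v == val z) then p else parv v.
(* The shift by 2 leaves depth 1 for [p], strictly between [x] and all other vertices. *)
pose dep' v := if v == p then 1%N else if v == val x then 0%N
  else (depv v).+2.
have parvE u : parv (val u) = val (par u) by rewrite /parv valK.
have depvE u : depv (val u) = dep u by rewrite /depv valK.
have val_p (u : verts T) : (val u == p) = false.
  by apply: contraNF pT => /eqP <-; exact: fsvalP.
have par'E (u : verts T) :
    par' (fsval u) = if (u == y) || (u == z) then p else fsval (par u).
  by rewrite /par' val_p !val_eqE parvE.
have par'p : par' p = val x by rewrite /par' eqxx.
have xT' : val x \in (p |` verts T)%fset by rewrite in_fsetU (valP x) orbT.
have parP' v : v \in (p |` verts T)%fset -> v != val x ->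
    par' v \in (p |` verts T)%fset /\ (dep' (par' v) < dep' v)%N.
  rewrite in_fset1U => /predU1P[-> _|vT vx].
    by rewrite /par' /dep' !eqxx val_p xT'.
  pose u := [` vT]%fset; have ux : u != x by [].
  have [_ du] := parP _ ux.
  rewrite -[v]/(val u) par'E; case: ifP => _.
    by rewrite fset1U1 /dep' eqxx val_p val_eqE (negPf ux).
  rewrite /dep' !val_p !depvE !val_eqE (negPf ux) in_fsetU (valP (par u)) orbT.
  by case: ifP.
exists (parent_tree xT' parP') => //.
apply: le_trans (parent_tree_length xT' parP' nm0 nmN) _.
rewrite big_mkcond big_fsetU1 // -big_mkcond big_seq_fsetE /= par'p eq_sym val_p /=.
have zP : (z != x) && (z != y) by rewrite ne_x //= eq_sym.
have := tree_length_ge nm0 nmN parP.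
rewrite (bigD1 y) ?ne_x // (bigD1 z zP) !parx //= => lenT.
rewrite (eq_bigl (fun v => v != x)) // [X in _ + X <= _](bigD1 y) ?ne_x //=.
rewrite [X in _ + (_ + X) <= _](bigD1 z zP) /= !par'E !eqxx orbT.
under [X in _ + (_ + (_ + X)) <= _]eq_bigr => v /andP[/andP[_ vy] vz].
  by rewrite par'E (negPf vy) (negPf vz); over.
by move: lenT; set rest := \sum_(v | _) _; set len := tree_length _ _; lra.
Qed.

(** * Upper bound on degrees in a minimal tree *)

Section Norm.
Variables (R : realType) (n : nat) (lam : R).
Hypothesis lam_gt0 : 0 < lam.
Implicit Types (u : 'rV[R]_n) (i : 'I_n) (t : R).

Lemma norm12N u : norm12 lam (- u) = norm12 lam u.
Proof.
rewrite /norm12 /l1norm /l2norm; congr (_ + _ * Num.sqrt _).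
  by apply: eq_bigr => i _; rewrite mxE normrN.
by apply: eq_bigr => i _; rewrite mxE sqrrN.
Qed.

Lemma norm12_ge0 u : 0 <= norm12 lam u.
Proof.
rewrite addr_ge0 ?mulr_ge0 ?sqrtr_ge0 ?(ltW lam_gt0) //.
by apply: sumr_ge0.
Qed.

Lemma norm12_delta t i : norm12 lam (t *: delta_mx ord0 i) = (1 + lam) * `|t|.
Proof.
have coord j : (t *: delta_mx ord0 i : 'rV_n) ord0 j = t *+ (j == i).
  by rewrite !mxE eqxx /= mulr_natr.
rewrite /norm12 /l1norm /l2norm (bigD1 i) //= big1 => [|j /negPf ji].
  rewrite (bigD1 i) //= big1 => [|j /negPf ji].
    by rewrite coord eqxx mulr1n !addr0 sqrtr_sqr mulrDl mul1r.
  by rewrite coord ji expr0n.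
by rewrite coord ji normr0.
Qed.

(** Coordinate [i] moves towards 0 without crossing it: the l1 part drops by exactly [|t|] and the
    l2 part strictly. Strictness is what contradicts minimality when [lam = 1]. *)
Lemma norm12_sub_delta u i t : 0 < t * u ord0 i -> `|t| <= `|u ord0 i| ->
  norm12 lam (u - t *: delta_mx ord0 i) < norm12 lam u - `|t|.
Proof.
move=> tu le_tu; set v := u - _.
have vi : v ord0 i = u ord0 i - t by rewrite !mxE !eqxx mulr1.
have vj j : j != i -> v ord0 j = u ord0 j.
  by move=> /negPf ji; rewrite !mxE ji andbF mulr0 subr0.
have cases : (0 < t /\ t <= u ord0 i) \/ (t < 0 /\ u ord0 i <= t).
  case: (ltrgt0P t) tu le_tu => [t0|t0|->]; last by rewrite mul0r ltxx.
    by rewrite pmulr_rgt0 // => u0; rewrite gtr0_norm //; left.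
  by rewrite nmulr_rgt0 // => u0; rewrite ltr0_norm // lerN2; right.
have l1E : l1norm v = l1norm u - `|t|.
  rewrite /l1norm (bigD1 i) //= [in RHS](bigD1 i) //= vi (eq_bigr (fun j => `|u ord0 j|)).
    suff -> : `|u ord0 i - t| = `|u ord0 i| - `|t| by rewrite addrAC.
    case: cases => -[t0 tu0].
      by rewrite !ger0_norm ?subr_ge0 // ltW // (lt_le_trans t0).
    by rewrite !ler0_norm ?subr_le0 // ?ltW // ?(le_lt_trans tu0) // opprB opprK addrC.
  by move=> j ji; rewrite vj.
have l2lt : l2norm v < l2norm u.
  rewrite /l2norm ltr_sqrt; last first.
    rewrite (bigD1 i) //= ltr_pwDl ?sumr_ge0 // => [|j _]; last exact: sqr_ge0.
    by rewrite exprn_even_gt0 //=; case: cases => -[t0 tu0]; lra.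
  rewrite (bigD1 i) //= [ltRHS](bigD1 i) //= vi (eq_bigr (fun j => u ord0 j ^+ 2)).
    by rewrite ltrD2r; case: cases => -[t0 tu0]; nra.
  by move=> j ji; rewrite vj.
by rewrite /norm12 l1E addrAC ltrD2r ltrD2l ltr_pM2l.
Qed.

(** Half of the least positive offset in coordinate [i], capped by [m], works: a point of [V]
    reached by such a step would have a smaller positive offset. *)
Lemma exists_fresh_step (V : {fset 'rV[R]_n}) (x : 'rV[R]_n) i (m : R) :
  0 < m -> exists t, [/\ 0 < t, t <= m
    & forall s, `|s| = t -> x + s *: delta_mx ord0 i \notin V].
Proof.
move=> m0; pose f (v : V) : R := `|(val v - x) ord0 i|.
pose t := \big[Num.min/m]_(v : V | 0 < f v) f v.
have t0 : 0 < t by apply: lt_bigmin.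
exists (t / 2); split; first by rewrite divr_gt0.
  apply: le_trans (bigmin_le_id _ _ _ _ : t <= m).
  by rewrite ler_pdivrMr // ler_peMr ?(ltW t0) // ler1n.
move=> s st; apply/negP => sV; pose v : V := [` sV]%fset.
have fv : f v = t / 2.
  by rewrite /f /= addrAC subrr add0r !mxE !eqxx mulr1.
have : t <= f v by apply: bigmin_le_cond; rewrite fv divr_gt0.
by rewrite fv; lra.
Qed.

Lemma smt_neighbor_sign (N : {fset 'rV[R]_n}) (T : point_tree R n)
    (x y z : verts T) i :
  lam <= 1 -> steiner_minimal_tree (norm12 lam) N T ->
  adj x y -> adj x z ->
  0 < (val y - val x) ord0 i * (val z - val x) ord0 i -> y = z.
Proof.
move=> lam1 [NT Tmin] xy xz; set u := val y - val x; set w := val z - val x.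
move=> uw; apply/eqP/negPn/negP => yz.
have [asym _ _ _ _] := adj_tree T.
have u0 : u ord0 i != 0 by apply: contraTneq uw => ->; rewrite mul0r ltxx.
have w0 : w ord0 i != 0 by apply: contraTneq uw => ->; rewrite mulr0 ltxx.
have m0 : 0 < Num.min `|u ord0 i| `|w ord0 i|.
  by rewrite lt_min !normr_gt0 u0.
(* The bound by the minimum keeps the move from crossing 0 on either edge. *)
have [t [t0 + fresh]] := exists_fresh_step (verts T) (val x) i m0.
rewrite le_min => /andP[tu tw].
pose s := Num.sg (u ord0 i) * t.
have st : `|s| = t by rewrite normrM normr_sg u0 mul1r gtr0_norm.
pose d : 'rV[R]_n := s *: delta_mx ord0 i.
have su : 0 < s * u ord0 i.
  by rewrite mulrAC -normrEsg ?pmulr_rgt0 ?normr_gt0.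
have sw : 0 < s * w ord0 i.
  rewrite -(pmulr_rgt0 _ su) mulrACA -expr2 pmulr_rgt0 //.
  by rewrite exprn_even_gt0 //= -normr_gt0 st.
have := @add_steiner_point _ _ _ T x y z (val x + d) norm12_ge0 norm12N yz.
rewrite asym xy asym xz fresh // => /(_ isT isT isT)[T' vT' lenT'].
have NT' : steiner_tree N T'.
  by rewrite /steiner_tree vT'; apply: fsubset_trans NT _; apply: fsubsetUr.
have := le_trans (Tmin _ NT') lenT'.
have -> : val x + d - val x = d by rewrite addrAC subrr add0r.
rewrite !(opprD (val x)) !(addrA _ (- val x)) -/u -/w norm12_delta st.
have := norm12_sub_delta su; rewrite st => /(_ tu).
have := norm12_sub_delta sw; rewrite st => /(_ tw).
have : lam * t <= t by rewrite ler_piMl // ltW.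
rewrite -/d; lra.
Qed.

Lemma smt_degree_le (N : {fset 'rV[R]_n}) (T : point_tree R n) (x : verts T) :
  (0 < n)%N -> lam <= 1 -> steiner_minimal_tree (norm12 lam) N T ->
  (degree x <= 2 * n)%N.
Proof.
move=> n0 lam1 Tmin; have [_ airr _ _ _] := adj_tree T.
pose c (y : verts T) i := (val y - val x) ord0 i.
(* Each neighbour is labelled by a coordinate where it differs from [x] and the sign there; equal
   labels will force equal neighbours. *)
pose g y := let i := odflt (Ordinal n0) [pick i | c y i != 0] in (0 < c y i, i).
have gP y : adj x y -> c y (g y).2 != 0.
  move=> xy; rewrite /g; case: pickP => //= cy0.
  suff yx : y = x by rewrite yx airr in xy.
  apply/val_inj/eqP; rewrite -subr_eq0; apply/eqP/rowP => i; rewrite [RHS]mxE.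
  by apply/eqP/negPn; rewrite -[_ == 0]/(c y i == 0) cy0.
have <- : #|{: bool * 'I_n}| = (2 * n)%N by rewrite card_prod card_bool card_ord.
apply: (@leq_card_in _ _ g) => y z; rewrite !inE => xy xz gyz.
apply: (smt_neighbor_sign lam1 Tmin xy xz (i := (g y).2)).
have cy := gP _ xy; have := gP _ xz; rewrite -gyz => cz.
have : (0 < c y (g y).2) = (0 < c z (g z).2) := congr1 fst gyz.
rewrite -gyz -/(c y (g y).2) -/(c z (g y).2).
case: (ltrgt0P (c y _)) cy => // cy _; case: (ltrgt0P (c z _)) cz => // cz _ _.
  by rewrite mulr_gt0.
by rewrite nmulr_rgt0.
Qed.

End Norm.

(** * Balanced weights on a laminar family *)

Lemma neq_set1 (T : finType) (X : {set T}) (a : T) :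
  a \in X -> X != [set a] -> exists2 k, k \in X & k != a.
Proof.
move=> aX.
rewrite finset.eqEsubset finset.sub1set aX andbT => /fintype.subsetPn[k kX].
by rewrite inE => ka; exists k.
Qed.

(** Complementing [S] exchanges the disjuncts: what counts is the cut of [D], with [c] alone on one
    of its sides. *)
Definition isolates (T : finType) (D S : {set T}) (c : T) : bool :=
  (S :&: D == [set c]) || (D :\: S == [set c]).

(* [k] and [l] are found just inside the smallest, resp. just outside the
   largest, of the sets that separate [a] from [b] and isolate neither.  If
   there is no such set, [k = l = a] makes the later correction vanish. *)
Lemma laminar_witnesses (T I : finType) (D : {set T}) (S : I -> {set T})
    (a b : T) :
  a \in D -> b \in D ->
  (forall u v, [|| S u \subset S v, S v \subset S u | [disjoint S u & S v]]) ->
  exists k l, [/\ k \in D, l \in D,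
    k = a /\ l = a \/ [/\ k != a, k != b, l != a & l != b]
    & forall v, (a \in S v) != (b \in S v) ->
      ~~ isolates D (S v) a -> ~~ isolates D (S v) b ->
      (k \in S v) = (a \in S v) /\ (l \in S v) = (b \in S v)].
Proof.
move=> aD bD lam.
pose F v := [&& (a \in S v) != (b \in S v), ~~ isolates D (S v) a
  & ~~ isolates D (S v) b].
(* The side of the cut that contains [a]. Among cuts separating [a] from [b], laminarity makes these
   sides a chain. *)
pose A v := if a \in S v then S v else ~: S v.
have chain u v : F u -> F v -> (A u \subset A v) || (A v \subset A u).
  case/andP=> uab _ /andP[vab _]; have := lam u v; rewrite /A.
  case: ifP uab => au; case: ifP vab => av; rewrite ?finset.setCS.
  - move=> _ _ /or3P[->|->|]; rewrite ?orbT //.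
    by move/pred0P/(_ a); rewrite /= au av.
  - move=> bv; have {}bv : b \in S v by case: (b \in S v) bv.
    move=> bu; have {}bu : b \notin S u by case: (b \in S u) bu.
    case/or3P=> [/fintype.subsetP/(_ a au)|/fintype.subsetP/(_ b bv)|].
    + by rewrite av.
    + by rewrite (negPf bu).
    + by rewrite finset.disjoints_subset => ->.
  - move=> bv; have {}bv : b \notin S v by case: (b \in S v) bv.
    move=> bu; have {}bu : b \in S u by case: (b \in S u) bu.
    case/or3P=> [/fintype.subsetP/(_ b bu)|/fintype.subsetP/(_ a av)|].
    + by rewrite (negPf bv).
    + by rewrite au.
    + by rewrite disjoint_sym finset.disjoints_subset => ->; rewrite orbT.
  - move=> bv; have {}bv : b \in S v by case: (b \in S v) bv.
    move=> bu; have {}bu : b \in S u by case: (b \in S u) bu.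
    move=> /or3P[->|->|]; rewrite ?orbT //.
    by move/pred0P/(_ b); rewrite /= bu bv.
have [v0 F0|F0] := pickP F; last first.
  exists a, a; split=> //; first by left.
  by move=> v h1 h2 h3; have := F0 v; rewrite /F h1 h2 h3.
have aA v : a \in A v by rewrite /A; case: ifP => // av; rewrite inE av.
have bA v : F v -> b \notin A v.
  case/andP=> + _; rewrite /A; case: ifP => _; rewrite ?inE ?negbK.
    by case: (b \in _).
  by case: (b \in _).
have AI v : F v -> (A v :&: D != [set a]) && (D :\: A v != [set b]).
  case/and3P=> _; rewrite /A /isolates !negb_or => /andP[h1 h2] /andP[h3 h4].
  case: ifP => _; first by rewrite h1 h4.
  rewrite finset.setDE finset.setCK [_ :&: D]finset.setIC -finset.setDE.
  by rewrite [D :&: _]finset.setIC h2 h3.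
have [m Fm minm] := arg_minnP (fun v => #|A v|) F0.
have [M FM maxM] := arg_maxnP (fun v => #|A v|) F0.
have subm v : F v -> A m \subset A v.
  move=> Fv; case/orP: (chain _ _ Fm Fv) => // sub.
  have /eqP -> // : A v == A m by rewrite eqEcard sub minm.
have subM v : F v -> A v \subset A M.
  move=> Fv; case/orP: (chain _ _ FM Fv) => // sub.
  have /eqP -> // : A M == A v by rewrite eqEcard sub; apply: maxM.
have /andP[nm _] := AI _ Fm; have /andP[_ nM] := AI _ FM.
have [|k + ka] := neq_set1 _ nm; first by rewrite inE aA.
rewrite inE => /andP[km kD].
have [|l + lb] := neq_set1 _ nM; first by rewrite inE bD bA.
rewrite inE => /andP[lM lD].
exists k, l; split=> //.
  right; split=> //; first by apply: contraNneq (bA _ Fm) => <-.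
  by apply: contraNneq lM => ->.
move=> v h1 h2 h3; have Fv : F v by rewrite /F h1 h2 h3.
have kv := fintype.subsetP (subm _ Fv) _ km.
have lv : l \notin A v by apply: contraNN lM; apply: fintype.subsetP (subM _ Fv) _.
move: kv lv h1; rewrite /A; case: ifP => av.
  by move=> -> /negPf ->; case: (b \in _).
by rewrite !inE negbK => /negPf -> ->; case: (b \in _).
Qed.

Lemma sum_indic (R : nzRingType) (T : finType) (X : {set T}) (c : T) :
  \sum_(w in X) (w == c)%:R = (c \in X)%:R :> R.
Proof.
rewrite big_mkcond (bigD1 c) //= eqxx big1 ?addr0; first by case: (c \in X).
by move=> w /negPf ->; rewrite if_same.
Qed.

(** If a cut does not separate [a] from [b], only the terms at [k] and [l] survive, at most 1 in
    size. If it separates them and isolates neither, [k] sides with [a] and [l] with [b], leaving (1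
    + lam) - 1 = lam. If it isolates one, [k] and [l] cancel and 1 + lam remains. *)
Lemma exists_balanced_weight (R : realType) (T I : finType) (D : {set T})
    (S : I -> {set T}) (a b : T) (lam : R) :
  0 < lam -> a != b -> a \in D -> b \in D ->
  (forall u v, [|| S u \subset S v, S v \subset S u | [disjoint S u & S v]]) ->
  exists d : T -> R,
    [/\ d a = 1 + lam, d b = - (1 + lam), forall w, w \notin D -> d w = 0,
        \sum_w d w = 0
      & forall v, let s := `|\sum_(w in S v) d w| in
        [/\ s <= 1 + lam, (a \in S v) = (b \in S v) -> s <= 1
          & s <= Num.max 1 lam \/ isolates D (S v) a || isolates D (S v) b]].
Proof.
move=> lam0 ab aD bD lamS.
have [k [l [kD lD kl klS]]] := laminar_witnesses aD bD lamS.
pose d w : R := (1 + lam) * ((w == a)%:R - (w == b)%:R)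
  - (w == k)%:R + (w == l)%:R.
have sumd (X : {set T}) : \sum_(w in X) d w =
    (1 + lam) * ((a \in X)%:R - (b \in X)%:R) - (k \in X)%:R + (l \in X)%:R.
  by rewrite big_split /= sumrB -mulr_sumr sumrB /= !sum_indic.
(* The correction leaves the weights at [a] and [b] unchanged. *)
have kl_eq c : (c == a) || (c == b) -> (c == k) = (c == l).
  case: kl => [[-> ->]//|[ka kb la lb]].
  by case/orP=> /eqP ->; rewrite ![_ == k]eq_sym ![_ == l]eq_sym;
    rewrite ?(negPf ka) ?(negPf kb) ?(negPf la) ?(negPf lb).
(* Unless [k = l] already, both are nodes other than [c], hence both lie on the side opposite to
   [c]. *)
have iso_kl (X : {set T}) c : (c == a) || (c == b) -> isolates D X c ->
    (k \in X) = (l \in X).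
  case: kl => [[-> ->]//|[ka kb la lb]] cab.
  have [kc lc] : k != c /\ l != c by case/orP: cab => /eqP ->.
  have inX e : e \in D -> e != c -> isolates D X c ->
      (e \in X) = (X :&: D != [set c]).
    move=> eD ec; rewrite /isolates; case: eqP => [XD _|_ /= /eqP DX].
      have := finset.in_set1 e c.
      by rewrite -XD inE eD andbT (negPf ec).
    have := finset.in_set1 e c.
    by rewrite -DX inE eD andbT (negPf ec) => /negPn ->.
  by move=> iso; rewrite !inX.
exists d; split.
- by rewrite /d eqxx (negPf ab) (kl_eq a) ?eqxx //=; ring.
- by rewrite /d eqxx eq_sym (negPf ab) (kl_eq b) ?eqxx ?orbT //=; ring.
- move=> w wD; have ne c : c \in D -> (w == c) = false.
    by move=> cD; apply: contraNF wD => /eqP ->.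
  by rewrite /d !ne //=; ring.
- have := sumd [set: T]; rewrite !inE => sumT.
  under eq_bigl => w do rewrite -(finset.in_setT w).
  by rewrite sumT; ring.
move=> v s.
have small (x y : bool) : `|- x%:R + y%:R : R| <= 1.
  by case: x; case: y; rewrite ?oppr0 ?addr0 ?add0r ?addNr ?normrN ?normr1 ?normr0.
have same : (a \in S v) = (b \in S v) -> s <= 1.
  by move=> abv; rewrite /s sumd abv subrr mulr0 add0r.
have diff (x y : bool) : x != y -> `|x%:R - y%:R : R| = 1.
  by case: x; case: y => // _; rewrite ?subr0 ?sub0r ?normrN normr1.
have [abv|abv] := eqVneq (a \in S v) (b \in S v).
  split=> //; last by left; rewrite le_max same.
  by rewrite (le_trans (same abv)) // lerDl ltW.
have [iso|] := boolP (isolates D (S v) a || isolates D (S v) b).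
  split; [|by move=> abv'; rewrite abv' eqxx in abv|by right].
  have klv : (k \in S v) = (l \in S v).
    by case/orP: iso; apply: iso_kl; rewrite eqxx ?orbT.
  rewrite /s sumd klv subrK normrM diff // mulr1 ger0_norm //.
  by rewrite addr_ge0 // ltW.
rewrite negb_or => /andP[na nb]; have [kE lE] := klS v abv na nb.
have sE : s = lam.
  rewrite /s sumd kE lE (_ : _ + _ = lam * ((a \in S v)%:R - (b \in S v)%:R)).
    by rewrite normrM diff // mulr1 gtr0_norm.
  by ring.
split; first by rewrite sE lerDr.
  by move=> abv'; rewrite abv' eqxx in abv.
by left; rewrite sE le_max lexx orbT.
Qed.

(** * Ancestors in a rooted tree *)

(** The sum telescopes along the path from [w] up to the root. *)
Lemma sum_ancestors (V : zmodType) (T : finType) (r : T) (par : T -> T)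
    (dep : T -> nat) (F : T -> V) (w : T) :
  par r = r -> (forall v, v != r -> (dep (par v) < dep v)%N) ->
  \sum_(v | (v != r) && fconnect par w v) (F v - F (par v)) = F w - F r.
Proof.
move=> parr parP; have [m] := ubnP (dep w); elim: m w => // m IH w.
have connr v : fconnect par r v = (v == r).
  apply/idP/eqP => [/iter_findex <-|->]; last exact: connect0.
  by elim: (findex _ _ _) => //= i ->.
have [->|wr] := eqVneq w r.
  rewrite subrr big_pred0 // => v.
  by rewrite connr; case: eqP.
rewrite ltnS => dw; rewrite (bigD1 w) ?wr ?connect0 //=.
have lt := parP _ wr.
have dep_le u : fconnect par (par w) u -> (dep u <= dep (par w))%N.
  move/iter_findex => <-; elim: (findex _ _ _) => //= i; apply: leq_trans.
  set x := iter _ _ _; have [->|/parP/ltnW//] := eqVneq x r.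
  by rewrite parr.
rewrite (eq_bigl (fun v => (v != r) && fconnect par (par w) v)) => [|v].
  by rewrite IH ?(leq_trans lt) // addrA subrK.
(* The ancestors of [w] other than [w] are those of [par w]; depth keeps [w] out of the latter. *)
rewrite -andbA; congr (_ && _); apply/andP/idP => [[wv vw]|pv].
  apply: contraTT wv => npv; apply/negP => /iter_findex.
  case: (findex _ _ _) => [|i] /= E; first by rewrite E eqxx in vw.
  by case/negP: npv; rewrite -E -iterS iterSr fconnect_iter.
split; first by apply: connect_trans pv; apply: fconnect1.
by apply: contraTneq (dep_le _ pv) => ->; rewrite -ltnNge.
Qed.

(** All ancestors of [w] lie on one path, so two subtrees that meet are nested. *)
Lemma fconnect_chain (T : finType) (f : T -> T) (w u v : T) :
  fconnect f w u -> fconnect f w v -> fconnect f u v || fconnect f v u.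
Proof.
move=> /iter_findex <- /iter_findex <-.
set i := findex _ _ u; set j := findex _ _ v.
wlog ij : i j / (i <= j)%N.
  by case/orP: (leq_total i j) => ij H; [|rewrite orbC]; apply: H.
by rewrite -(subnK ij) iterD fconnect_iter.
Qed.

(** * The dual ball and the points +-e_i *)

Section Duality.
Variables (R : realType) (n : nat) (lam : R).
Hypothesis lam_gt0 : 0 < lam.

(** Cauchy-Schwarz against the all-ones vector: square, then use 2xy <= x^2 + y^2 for each pair of
    coordinates. *)
Lemma l1norm_le_l2norm (u : 'rV[R]_n) :
  l1norm u <= Num.sqrt n%:R * l2norm u.
Proof.
rewrite /l2norm -sqrtrM ?ler0n // -[leLHS]ger0_norm ?sumr_ge0 // -sqrtr_sqr.
rewrite ler_wsqrtr // expr2 /l1norm big_distrlr /=.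
apply: (@le_trans _ _
  (\sum_i \sum_j 2^-1 * (u ord0 i ^+ 2 + u ord0 j ^+ 2))).
  apply: ler_sum => i _; apply: ler_sum => j _.
  rewrite -(real_normK (num_real (u ord0 i))) -(real_normK (num_real (u ord0 j))).
  set x := `|_|; set y := `|_|; have := sqr_ge0 (x - y); nra.
rewrite (eq_bigr (fun i => 2^-1 *
    (u ord0 i ^+ 2 *+ n + \sum_j u ord0 j ^+ 2))) => [|i _].
  rewrite -mulr_sumr big_split /= sumr_const card_ord sumrMnl mulr_natl.
  by set q := _ *+ n; lra.
by rewrite -mulr_sumr big_split /= sumr_const card_ord.
Qed.

(* This lemma and the next describe vectors of the dual unit ball, which is
   the sum of the cube [-1, 1]^n and the Euclidean ball of radius [lam]. *)
Lemma pairing_le_norm12_small (a : 'I_n -> R) (u : 'rV[R]_n) :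
  (lam - 1) * Num.sqrt n%:R <= lam -> (forall i, `|a i| <= Num.max 1 lam) ->
  \sum_i a i * u ord0 i <= norm12 lam u.
Proof.
move=> hlam ha; apply: (@le_trans _ _ (Num.max 1 lam * l1norm u)).
  rewrite mulr_sumr; apply: ler_sum => i _.
  by apply: le_trans (ler_norm _) _; rewrite normrM ler_wpM2r.
have l2 : 0 <= l2norm u := sqrtr_ge0 _.
have l12 := l1norm_le_l2norm u.
rewrite /norm12; have [lam1|lam1] := leP lam 1.
  by rewrite mul1r lerDl mulr_ge0 // ltW.
(* The excess of (lam - 1) times the l1 norm is at most (lam - 1) sqrt n times the l2 norm, which
   [hlam] bounds by the l2 part. *)
rewrite -lerBlDl -[X in _ - X]mul1r -mulrBl.
apply: le_trans (ler_wpM2l _ l12) _; first by rewrite subr_ge0 ltW.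
by rewrite mulrA ler_wpM2r.
Qed.

Lemma pairing_le_norm12_leaf (a : 'I_n -> R) (u : 'rV[R]_n) (i0 : 'I_n) :
  `|a i0| <= 1 + lam -> (forall i, i != i0 -> `|a i| <= 1) ->
  \sum_i a i * u ord0 i <= norm12 lam u.
Proof.
move=> hi0 hi; have ui0 : `|u ord0 i0| <= l2norm u.
  rewrite -sqrtr_sqr ler_wsqrtr // (bigD1 i0) //= lerDl sumr_ge0 // => i _.
  exact: sqr_ge0.
have le_norm i c : `|a i| <= c -> a i * u ord0 i <= c * `|u ord0 i|.
  move=> h; apply: le_trans (ler_norm _) _.
  by rewrite normrM ler_wpM2r.
(* The surplus [lam] at [i0] is absorbed by the l2 part, through [ui0]. *)
rewrite (bigD1 i0) //= /norm12 /l1norm [X in _ <= X + _](bigD1 i0) //= addrAC lerD //.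
  apply: le_trans (le_norm _ _ hi0) _.
  by rewrite mulrDl mul1r lerD2l ler_pM2l.
by apply: ler_sum => i /hi /le_norm; rewrite mul1r.
Qed.

Definition cross_vertex (s : bool * 'I_n) : 'rV[R]_n :=
  (-1) ^+ s.1 *: delta_mx ord0 s.2.

Definition cross_vertices : {fset 'rV[R]_n} :=
  [fset cross_vertex s | s in {: bool * 'I_n}]%fset.

Lemma cross_vertexE s i :
  cross_vertex s ord0 i = (-1) ^+ s.1 *+ (i == s.2).
Proof. by rewrite !mxE eqxx mulr_natr. Qed.

Lemma cross_vertex_inj : injective cross_vertex.
Proof.
move=> [s i] [t j] E; have := cross_vertexE (t, j) i.
rewrite -E cross_vertexE /= eqxx; case: eqP => [->|_]; first by move/signr_inj ->.
by move/eqP; rewrite signr_eq0.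
Qed.

Lemma cross_verticesP s : cross_vertex s \in cross_vertices.
Proof. exact: in_imfset. Qed.

Lemma norm12_cross_vertex s : norm12 lam (cross_vertex s) = 1 + lam.
Proof. by rewrite norm12_delta normr_sign mulr1. Qed.

Lemma zero_notin_cross : 0 \notin cross_vertices.
Proof.
apply/negP => /imfsetP[s _] /rowP/(_ s.2)/eqP.
by rewrite cross_vertexE eqxx mxE eq_sym signr_eq0.
Qed.

End Duality.

(** * Minimality of the star on the points +-e_i *)

Section CrossPolytope.
Variables (R : realType) (n : nat) (lam : R).
Hypothesis lam_gt0 : 0 < lam.

Lemma steiner_tree_cross_ge (T : point_tree R n) :
  (lam - 1) * Num.sqrt n%:R <= lam -> steiner_tree (cross_vertices R n) T ->
  (2 * n)%:R * (1 + lam) <= tree_length (norm12 lam) T.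
Proof.
move=> hlam /fsubsetP NT; have [_ _ /card_gt0P[r _] conn _] := adj_tree T.
have [par [dep [parr parP _]]] := exists_parent (fun v => conn v r).
have dep_lt v : v != r -> (dep (par v) < dep v)%N by case/parP.
pose nd s : verts T := [` NT _ (cross_verticesP R s)]%fset.
have nd_inj : injective nd by move=> s t /(congr1 val); apply: cross_vertex_inj.
pose D : {set verts T} := [set nd s | s in {: bool * 'I_n}].
have ndD s : nd s \in D by apply: imset_f.
(* The subtree of [v], one side of the edge from [v] to its parent. *)
pose S (v : verts T) : {set verts T} := [set w | fconnect par w v].
have lamS u v : [|| S u \subset S v, S v \subset S u | [disjoint S u & S v]].
  have [|/pred0Pn[w /andP[]]] := boolP [disjoint S u & S v].
    by rewrite !orbT.
  rewrite !inE => wu wv.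
  by case/orP: (fconnect_chain wu wv) => uv; apply/orP; [left|right];
    [|apply/orP; left]; apply/fintype.subsetP => x; rewrite !inE => xu;
    apply: connect_trans uv.
have nd_ne i : nd (false, i) != nd (true, i) by rewrite (inj_eq nd_inj).
have [d dP] := boolp.choice (fun i =>
  exists_balanced_weight lam_gt0 (nd_ne i) (ndD _) (ndD _) lamS).
pose phi v i := \sum_(w in S v) d i w.
have phi_le v (u : 'rV_n) : \sum_i phi v i * u ord0 i <= norm12 lam u.
  have [/forallP small|] := boolP [forall i, `|phi v i| <= Num.max 1 lam].
    exact: pairing_le_norm12_small.
  rewrite negb_forall => /existsP[i big].
  have [_ _ _ _ /(_ v)[le _ iso]] := dP i.
  apply: (@pairing_le_norm12_leaf _ _ _ lam_gt0 _ _ i) => // j ji.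
  have [_ _ _ _ /(_ v)[_ + _]] := dP j; apply.
  case: iso => [iso|iso]; first by rewrite iso in big.
  have [s {}iso] : exists s, isolates D (S v) (nd (s, i)).
    by case/orP: iso; [exists false | exists true].
  have nej s' : nd (s', j) != nd (s, i).
    by rewrite (inj_eq nd_inj) xpair_eqE (negPf ji) andbF.
  (* With +-e_i alone on its side, both e_j and -e_j lie on the other side, so coordinate [j] is at
     most 1. *)
  have inS s' : (nd (s', j) \in S v) = (S v :&: D != [set nd (s, i)]).
    move: iso; rewrite /isolates; have h := nej s'.
    case: eqP => [E _|_ /= /eqP E].
      have := finset.in_set1 (nd (s', j)) (nd (s, i)).
      by rewrite (negPf h) -E inE ndD andbT.
    have := finset.in_set1 (nd (s', j)) (nd (s, i)).
    by rewrite (negPf h) -E inE ndD andbT => /negPn ->.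
  by rewrite !inS.
apply: le_trans _ (tree_length_ge (@norm12_ge0 _ _ _ lam_gt0) (@norm12N _ _ _) parP).
apply: (@le_trans _ _ (\sum_(v | v != r)
    \sum_i phi v i * (val v - val (par v)) ord0 i)); last exact: ler_sum.
rewrite exchange_big /=.
suff E i : \sum_(v | v != r) phi v i * (val v - val (par v)) ord0 i = 2 * (1 + lam).
  by under eq_bigr => i _ do rewrite E; rewrite sumr_const card_ord -[leRHS]mulr_natl
    natrM [leRHS]mulrCA mulrA lexx.
have [da db dD d0 _] := dP i; pose F (v : verts T) : R := val v ord0 i.
(* After exchanging the sums, [w] meets exactly the edges on its path to the root, where the
   differences of [F] telescope. *)
transitivity (\sum_w d i w * (F w - F r)).
  transitivity (\sum_(v | v != r) \sum_(w | fconnect par w v) d i w * (F v - F (par v))).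
    apply: eq_bigr => v _; rewrite /phi mulr_suml; apply: eq_big => w.
      by rewrite inE.
    by move=> _; rewrite /F !mxE.
  rewrite (exchange_big_dep predT) //=; apply: eq_bigr => w _.
  by rewrite -mulr_sumr (sum_ancestors F w parr dep_lt).
under eq_bigr => w _ do rewrite mulrBr.
rewrite sumrB -mulr_suml d0 mul0r subr0.
rewrite (bigD1 (nd (false, i))) //= (bigD1 (nd (true, i))) /=; last first.
  by rewrite (inj_eq nd_inj).
rewrite big1 => [|w /andP[wa wb]].
  by rewrite da db /F /= !cross_vertexE eqxx /= !expr0 !expr1; ring.
(* Away from +-e_i nothing is left: other nodes have i-th coordinate 0, and all other vertices have
   weight 0. *)
have [/imsetP[[s j] _ E]|/dD ->] := boolP (w \in D); last by rewrite mul0r.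
rewrite /F E /= cross_vertexE /=; case: eqP => [ij|_]; last by rewrite mulr0.
by move: wa wb; rewrite E ij; case: s {E}; rewrite eqxx.
Qed.

Lemma card_cross : #|` cross_vertices R n| = (2 * n)%N.
Proof.
rewrite card_imfset; last exact: cross_vertex_inj.
by rewrite -cardT card_prod card_bool card_ord.
Qed.

Lemma cross_star_parent (v : 'rV[R]_n) :
  v \in (0 |` cross_vertices R n)%fset -> v != 0 ->
  0 \in (0 |` cross_vertices R n)%fset /\
  (nat_of_bool (0%R != 0%R :> 'rV[R]_n) < (v != 0%R))%N.
Proof. by move=> _ ->; rewrite fset1U1 eqxx. Qed.

Definition cross_star : point_tree R n :=
  parent_tree (par := fun _ => 0) (dep := fun v => nat_of_bool (v != 0))
    (fset1U1 0 (cross_vertices R n)) cross_star_parent.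

Lemma cross_star_length :
  tree_length (norm12 lam) cross_star <= (2 * n)%:R * (1 + lam).
Proof.
apply: le_trans (parent_tree_length _ _ (@norm12_ge0 _ _ _ lam_gt0) (@norm12N _ _ _)) _.
rewrite big_mkcond big_fsetU1 ?zero_notin_cross //= eqxx add0r.
rewrite -card_cross -sum1_size natr_sum mulr_suml !big_seq.
apply: ler_sum => v /imfsetP[s _ ->]; rewrite subr0 norm12_cross_vertex mul1r.
by case: ifP => // _; rewrite addr_ge0 // ltW.
Qed.

Lemma cross_star_degree (o : verts cross_star) :
  val o = 0 -> (2 * n <= degree o)%N.
Proof.
move=> o0; have <- : #|{: bool * 'I_n}| = (2 * n)%N.
  by rewrite card_prod card_bool card_ord.
have inV s : cross_vertex R s \in (0 |` cross_vertices R n)%fset.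
  by rewrite in_fset1U cross_verticesP orbT.
pose f s : verts cross_star := [` inV s]%fset.
have f_inj : injective f by move=> s t /(congr1 val); apply: cross_vertex_inj.
rewrite -(card_codom f_inj); apply/subset_leq_card/fintype.subsetP => _ /codomP[s ->].
rewrite inE /= /parent_adj /parent_rel o0 eqxx andbT; apply/orP; right.
apply: contraTneq (cross_verticesP R s) => E.
by rewrite -[cross_vertex R s]/(val (f s)) E zero_notin_cross.
Qed.

Lemma cross_star_minimal : (lam - 1) * Num.sqrt n%:R <= lam ->
  steiner_minimal_tree (norm12 lam) (cross_vertices R n) cross_star.
Proof.
move=> hlam; split=> [|T' NT']; first exact: fsubsetUr.
exact: le_trans cross_star_length (steiner_tree_cross_ge hlam NT').
Qed.

End CrossPolytope.

(** * Comparison of degrees and conclusion *)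

(** Declaring a Steiner point to be given keeps [T] minimal: every competitor for the larger set
    already competes for [N]. *)
Lemma steiner_degrees_sub_given (R : realType) (n : nat) (nm : 'rV[R]_n -> R) :
  (steiner_point_degrees nm `<=` given_point_degrees nm)%classic.
Proof.
move=> _ [N [T [x [[NT Tmin] _ <-]]]].
exists (val x |` N)%fset, T, x; split=> //; last exact: fset1U1.
split=> [|T' NT']; first by rewrite /steiner_tree fsubUset fsub1set (valP x).
by apply: Tmin; apply: fsubset_trans NT'; apply: fsubsetUr.
Qed.

Lemma max_steiner_le_given (R : realType) (n : nat) (nm : 'rV[R]_n -> R) :
  (max_steiner_degree nm <= max_given_degree nm)%E.
Proof.
by apply/le_ereal_sup/image_subset/steiner_degrees_sub_given.
Qed.

(** Clearing the denominator gives a form that covers n = 1 too, where sqrt n - 1 vanishes and the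
    inequality reads lam - 1 <= lam. *)
Lemma lambda_sqrt_bound (R : realType) (n : nat) (lam : R) :
  (1 <= n)%N -> 0 < lam ->
  n = 1%N \/ lam <= Num.sqrt n%:R / (Num.sqrt n%:R - 1) ->
  (lam - 1) * Num.sqrt n%:R <= lam.
Proof.
move=> n1 lam0 [->|]; first by rewrite sqrtr1 mulr1 gerBl.
have [-> _|n2] := eqVneq n 1%N; first by rewrite sqrtr1 mulr1 gerBl.
have s1 : 1 < Num.sqrt (n%:R : R).
  by rewrite -[X in X < _]sqrtr1 ltr_sqrt ?ltr0n // ltr1n ltn_neqAle eq_sym n2.
by rewrite ler_pdivlMr ?subr_gt0 //; nra.
Qed.

Theorem theorem7 (R : realType) (n : nat) (lam : R)
  (n_ge1 : (1 <= n)%N) (lam_gt0 : 0 < lam) :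
  (lam <= 1 ->
     (max_steiner_degree (@norm12 R n lam)
        <= max_given_degree (@norm12 R n lam))%E /\
     (max_given_degree (@norm12 R n lam) <= ((2 * n)%:R)%:E)%E) /\
  (n = 1%N \/ lam <= Num.sqrt (n%:R) / (Num.sqrt (n%:R) - 1) ->
     (max_steiner_degree (@norm12 R n lam)
        <= max_given_degree (@norm12 R n lam))%E /\
     (((2 * n)%:R)%:E <= max_steiner_degree (@norm12 R n lam))%E).
Proof.
split=> hlam; split; try exact: max_steiner_le_given.
  apply: ge_ereal_sup => _ [_ [N [T [x [Tmin _ <-]]]] <-].
  by rewrite lee_fin ler_nat (smt_degree_le lam_gt0 x n_ge1 hlam Tmin).
(* The centre 0 is not a given point, so its degree counts as that of a Steiner point. *)
pose o : verts (cross_star R n) := [` fset1U1 0 (cross_vertices R n)]%fset.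
apply: le_ereal_sup_tmp; exists (degree o)%:R%:E.
  exists (degree o) => //; exists (cross_vertices R n), (cross_star R n), o.
  split=> //; last exact: zero_notin_cross.
  exact/cross_star_minimal/lambda_sqrt_bound.
by rewrite lee_fin ler_nat cross_star_degree.
Qed.
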